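(* Let $\boldsymbol{S},\boldsymbol{J},\boldsymbol{R}\in\mathbb{R}^{n_z\times n_z}$ satisfy $\boldsymbol{S}=\boldsymbol{S}^{\top}\succ 0$, $\boldsymbol{J}^{\top}=-\boldsymbol{J}$, and $\boldsymbol{R}=\boldsymbol{R}^{\top}\succeq 0$. Set $\boldsymbol{A}_c=\boldsymbol{S}^{-1}(\boldsymbol{J}-\boldsymbol{R})$, let $\boldsymbol{B}_c\in\mathbb{R}^{n_z\times m}$ be the lifted input matrix defined in the context, and let $\tilde{H}(\boldsymbol{z})=\tfrac12\boldsymbol{z}^{\top}\boldsymbol{S}\boldsymbol{z}$. Let $h>0$ and let $\boldsymbol{z}_k,\boldsymbol{z}_{k+1}\in\mathbb{R}^{n_z}$ and $\boldsymbol{u}_k\in\mathbb{R}^m$ satisfy the implicit midpoint (Cayley-midpoint) discretization $$\frac{\boldsymbol{z}_{k+1}-\boldsymbol{z}_k}{h}=\boldsymbol{A}_c\bar{\boldsymbol{z}}_k+\boldsymbol{B}_c\boldsymbol{u}_k,\qquad \bar{\boldsymbol{z}}_k=\frac{\boldsymbol{z}_{k+1}+\boldsymbol{z}_k}{2}$$ of $\dot{\boldsymbol{z}}=\boldsymbol{A}_c\boldsymbol{z}+\boldsymbol{B}_c\boldsymbol{u}$. Put $\bar{\boldsymbol{y}}_k=\boldsymbol{B}_c^{\top}\boldsymbol{S}\bar{\boldsymbol{z}}_k$. Then the discretization preserves dissipativity with respect to the same storage function $\tilde H$; specifically, $$\tilde{H}(\boldsymbol{z}_{k+1})-\tilde{H}(\boldsymbol{z}_k)=-h\,\bar{\boldsymbol{z}}_k^{\top}\boldsymbol{R}\,\bar{\boldsymbol{z}}_k+h\,\bar{\boldsymbol{y}}_k^{\top}\boldsymbol{u}_k,$$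 and consequently $$\tilde{H}(\boldsymbol{z}_{k+1})-\tilde{H}(\boldsymbol{z}_k)\le h\,\bar{\boldsymbol{y}}_k^{\top}\boldsymbol{u}_k.$$
   Context: All matrices are real. The dimension is $n_z=2n_q+n_\phi$, where $n_q$ is the number of generalized coordinates of a mechanical system and $n_\phi$ is the number of additional lifting functions. The lifted input matrix is $$\boldsymbol{B}_c=\begin{bmatrix}\boldsymbol{0}_{n_q\times m}\\ \boldsymbol{S}_a\\ \boldsymbol{0}_{n_\phi\times m}\end{bmatrix}\in\mathbb{R}^{n_z\times m},$$ where $\boldsymbol{S}_a\in\mathbb{R}^{n_q\times m}$ is a given constant matrix (the generalized-force distribution matrix). $\succ 0$ and $\succeq 0$ mean positive definite and positive semidefinite. The number $h>0$ is the sampling interval, and the input is held constant, equal to $\boldsymbol{u}_k$, over the $k$-th sampling interval. *)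

(* Defs.v *)
(* MathComp matrices over the MathComp-Analysis real numbers (realType). *)
From HB Require Import structures.
From mathcomp Require Import all_boot all_order all_algebra.
From mathcomp Require Import reals.
Set Implicit Arguments.
Unset Strict Implicit.
Unset Printing Implicit Defensive.
Import Order.TTheory GRing.Theory Num.Theory.
Local Open Scope ring_scope.

(* A 1 x 1 product such as x^T *m M *m x is read as a scalar through its only
   entry (0, 0). *)

(* Neither predicate includes symmetry, which is always assumed separately. *)
Definition posdefmx (K : realType) (n : nat) (M : 'M[K]_n) : Prop :=
  forall x : 'cV[K]_n, x != 0 -> 0 < (x^T *m M *m x) 0 0.

Definition possemidefmx (K : realType) (n : nat) (M : 'M[K]_n) : Prop :=
  forall x : 'cV[K]_n, 0 <= (x^T *m M *m x) 0 0.

(* n_z = 2 n_q + n_phi; 2 n_q is written n_q + n_q so that block matrices of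
   this height typecheck without a cast. *)
Definition lifted_dim (nq nphi : nat) : nat := (nq + nq + nphi)%N.

Definition lifted_input (K : realType) (nq nphi m : nat) (Sa : 'M[K]_(nq, m)) :
    'M[K]_(lifted_dim nq nphi, m) :=
  col_mx (col_mx (0 : 'M[K]_(nq, m)) Sa) (0 : 'M[K]_(nphi, m)).

Definition storage (K : realType) (n : nat) (S : 'M[K]_n) (z : 'cV[K]_n) : K :=
  2^-1 * (z^T *m S *m z) 0 0.

Definition midpoint (K : realType) (n : nat) (z z' : 'cV[K]_n) : 'cV[K]_n :=
  2^-1 *: (z' + z).

(* One step, from z to z', of the implicit midpoint (Cayley-midpoint) scheme
   for dz/dt = A z + B u, the input being held equal to u during the step. *)
Definition implicit_midpoint_step (K : realType) (n m : nat)
    (A : 'M[K]_n) (B : 'M[K]_(n, m)) (h : K)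
    (z z' : 'cV[K]_n) (u : 'cV[K]_m) : Prop :=
  h^-1 *: (z' - z) = A *m midpoint z z' + B *m u.

(* Main.v *)
(* The storage is quadratic and S is symmetric, so H(z') - H(z) equals
   zbar^T S (z' - z) exactly.  Substituting the scheme, S cancels against
   S^-1, the skew part J drops out of the quadratic form in zbar, and what
   remains is the dissipated and the supplied energy. *)
Require Import Defs.
From HB Require Import structures.
From mathcomp Require Import all_boot all_order all_algebra.
From mathcomp Require Import reals.
From mathcomp Require Import ring lra.
Import Order.TTheory GRing.Theory Num.Theory.
Local Open Scope ring_scope.

(** A singular [M] kills some nonzero row [v] from the left, so its quadratic form vanishes at the
    nonzero column [v^T]. *)
Lemma posdefmx_unitmx {K : realType} {n : nat} (M : 'M[K]_n) :
  posdefmx M -> M \in unitmx.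
Proof.
move=> posM; rewrite unitmxE unitfE; apply/negP => /det0P [v v_neq0 vM0].
have vT_neq0 : v^T != 0 by rewrite -trmx0 (inj_eq trmx_inj).
by have := posM _ vT_neq0; rewrite trmxK vM0 mul0mx mxE ltxx.
Qed.

Lemma scalar_mx_tr {K : realType} (A : 'M[K]_1) : A^T 0 0 = A 0 0.
Proof. by rewrite mxE. Qed.

(** A scalar equals its own transpose, and transposing this one flips its sign. *)
Lemma skew_quadratic_form0 {K : realType} {n : nat} (J : 'M[K]_n) (x : 'cV[K]_n) :
  J^T = - J -> (x^T *m J *m x) 0 0 = 0.
Proof.
move=> skewJ; have := scalar_mx_tr (x^T *m J *m x).
rewrite !trmx_mul trmxK skewJ mulNmx mulmxN mulmxA mxE.
by move=> qN; lra.
Qed.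

(** Difference of squares: in the expansion of (z' + z)^T S (z' - z) the two cross terms cancel
    because [S] is symmetric. *)
Lemma storage_sub_midpoint {K : realType} {n : nat} (S : 'M[K]_n)
    (z z' : 'cV[K]_n) :
  S = S^T ->
  storage S z' - storage S z = ((midpoint z z')^T *m S *m (z' - z)) 0 0.
Proof.
move=> symS; have cross : (z^T *m S *m z') 0 0 = (z'^T *m S *m z) 0 0.
  by rewrite -scalar_mx_tr !trmx_mul trmxK -symS mulmxA.
rewrite /storage /midpoint [(_ *: _)^T]linearZ /= [(_ + _)^T]linearD /=.
rewrite -!scalemxAl mulmxBr !mulmxDl.
rewrite [RHS]mxE; move: cross.
by rewrite ![(_ + _ : 'M_1) _ _]mxE ![(- _ : 'M_1) _ _]mxE
  ![(_ + _ : 'M_1) _ _]mxE; lra.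
Qed.

Lemma midpoint_energy_balance {K : realType} {n m : nat} (S J R : 'M[K]_n)
    (B : 'M[K]_(n, m)) (h : K) (z z' : 'cV[K]_n) (u : 'cV[K]_m) :
  S = S^T -> S \in unitmx -> J^T = - J -> h != 0 ->
  implicit_midpoint_step (invmx S *m (J - R)) B h z z' u ->
  storage S z' - storage S z =
    - h * ((midpoint z z')^T *m R *m midpoint z z') 0 0
    + h * ((B^T *m S *m midpoint z z')^T *m u) 0 0.
Proof.
move=> symS unitS skewJ h_neq0 step; rewrite storage_sub_midpoint //.
have -> : z' - z = h *: (invmx S *m (J - R) *m midpoint z z' + B *m u).
  by rewrite -step scalerA divff // scale1r.
have := skew_quadratic_form0 J (midpoint z z') skewJ.
(* Both states now occur only through their midpoint, so the rest is algebra in a single vector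
   [w]. *)
move: (midpoint z z') => w wJw.
rewrite -scalemxAr mulmxDr !mulmxA mulmxK // mulmxBr mulmxBl.
(* Symmetry of [S] turns the supply term [(B^T *m S *m w)^T *m u] into [w^T *m S *m B *m u], as
   produced by the scheme. *)
rewrite !trmx_mul trmxK -symS !mulmxA.
by rewrite [LHS]mxE ![(_ + _ : 'M_1) _ _]mxE wJw ![(- _ : 'M_1) _ _]mxE; ring.
Qed.

Theorem mainTheorem2 (K : realType) (nq nphi m : nat)
    (Sa : 'M[K]_(nq, m))
    (S J R : 'M[K]_(lifted_dim nq nphi))
    (hSsym : S = S^T) (hSpos : posdefmx S)
    (hJ : J^T = - J)
    (hRsym : R = R^T) (hRpos : possemidefmx R)
    (h : K) (hh : 0 < h)
    (zk zk1 : 'cV[K]_(lifted_dim nq nphi)) (uk : 'cV[K]_m) :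
  let Ac := invmx S *m (J - R) in
  let Bc := lifted_input nphi Sa in
  let zbar := midpoint zk zk1 in
  let ybar := Bc^T *m S *m zbar in
  implicit_midpoint_step Ac Bc h zk zk1 uk ->
  storage S zk1 - storage S zk =
    - h * (zbar^T *m R *m zbar) 0 0 + h * (ybar^T *m uk) 0 0
  /\ storage S zk1 - storage S zk <= h * (ybar^T *m uk) 0 0.
Proof.
move=> Ac Bc zbar ybar step.
have balance :=
  midpoint_energy_balance S J R Bc h zk zk1 uk
    hSsym (posdefmx_unitmx S hSpos) hJ (lt0r_neq0 hh) step.
split; first exact: balance.
(* The dissipation term is nonpositive, since [R] is positive semidefinite and [h] is positive;
   dropping it gives the bound. *)
by rewrite balance mulNr gerDr oppr_le0 mulr_ge0 // ltW.
Qed.
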